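(* The semigroup $F_1$ is regular and it is weakly generated by $[x]$; that is, no proper regular subsemigroup of $F_1$ contains $[x]$.
   Context: A semigroup is regular if for each element $s$ there is $t$ with $sts=s$. A regular semigroup $S$ is weakly generated by an element if no proper regular subsemigroup of $S$ contains that element. **The set $G$.** Let $A=\{1,x,x'\}$ (three distinct symbols) with involution $'$ exchanging $x$ and $x'$ and fixing $1$. A 5-tuple is written $g=(g^{l},g^{la},g^{c},g^{ra},g^{r})$. Put $g_{xx'}=(1,1,x,x',1)$, $G_{1,e}=\{g_{xx'}\}$ and, for $i\ge 2$, $G_{i,e}=\{(g,(g^{la})',g^l,(g^{ra})',g),\ (g,(g^{ra})',g^l,(g^{la})',g) : g\in G_{i-1,e}\}$. Put $G_{1,d}=G_{2,d}=\emptyset$ and $G_i=G_{i,e}\cup G_{i,d}$, where recursively for $i\ge 3$, $G_{i,d}$ is the set of all $g\in G_{i-1}\times A\times G_{i-2}\times A\times G_{i-1}$ such that: (1) $g^l\neq g^r$; (2) $(g^c,g^{la})$ equals $((g^l)^l,((g^l)^{la})')$ or $((g^l)^r,((g^l)^{ra})')$; (3) $(g^c,g^{ra})$ equals $((g^r)^l,((g^r)^{la})')$ or $((g^r)^r,((g^r)^{ra})')$. Let $G^5=\bigcup_{i\ge1}G_i$, $G'=G^5\cup\{1\}$, $G=G^5\cup A$. The height is $\upsilon(1)=0$ and $\upsilon(g)=i$ for $g\in G_i$. **The semigroups $F_1^1$ and $F_1$.** For $g\in G^5$ with $\upsilon(g)\ge2$ let $g^L=(g^{la})'g^lg^{la}$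 and $g^R=(g^{ra})'g^rg^{ra}$, words in the free semigroup $G^+$. Let $\rho$ be the smallest congruence on $G^+$ containing the pairs $(xx'x,x)$, $(x'xx',x')$, $(g_{xx'},xx')$; the pairs $(1g,g)$, $(g1,g)$ for $g\in G$; the pairs $(g^2,g)$ for $g\in G'$; and, for every $g\in G^5$ with $\upsilon(g)\ge 2$, the pairs $(g^cg^Lg,g)$, $(gg^Rg^c,g)$ and $(g^rg^{ra}g(g^{la})'g^l,\ g^rg^{ra}g^c(g^{la})'g^l)$. Write $[u]$ for the $\rho$-class of $u$. Then $F_1^1=G^+/\rho$ is a monoid with identity $[1]$, and $F_1=F_1^1\setminus\{[1]\}$ is a subsemigroup. *)

(* Defs.v *)
From HB Require Import structures.
From mathcomp Require Import all_boot.
From mathcomp Require Import boolp classical_sets.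

Set Implicit Arguments.
Unset Strict Implicit.
Unset Printing Implicit Defensive.

Local Open Scope classical_set_scope.
Local Open Scope group_scope.

Section SemigroupNotions.
Variable S : semigroupType.

Definition regular_semigroup := forall s : S, exists t : S, s * t * s = s.

Definition subsemigroup (T : set S) :=
  T !=set0 /\ forall s t, T s -> T t -> T (s * t).

Definition regular_subsemigroup (T : set S) :=
  subsemigroup T /\ forall s, T s -> exists2 t, T t & s * t * s = s.

Definition weakly_generated_by (a : S) :=
  ~ exists T : set S, [/\ regular_subsemigroup T, T a & T `<` [set: S]].

Record congruence (E : S -> S -> Prop) : Prop := Congruence {
  congr_refl : forall u, E u u;
  congr_sym : forall u v, E u v -> E v u;
  congr_trans : forall u v w, E u v -> E v w -> E u w;
  congr_mul : forall u u' v v', E u u' -> E v v' -> E (u * v) (u' * v')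
}.

Definition gen_congruence (R : S -> S -> Prop) (u v : S) : Prop :=
  forall E, congruence E -> (forall a b, R a b -> E a b) -> E u v.

Variable R : S -> S -> Prop.

Lemma gen_congruenceP : congruence (gen_congruence R).
Proof.
split=> [u|u v uv|u v w uv vw|u u' v v' uu' vv'] E cE RE.
- exact: congr_refl.
- by apply: congr_sym => //; apply: uv.
- by apply: congr_trans (uv _ cE RE) (vw _ cE RE).
- by apply: congr_mul => //; [apply: uu' | apply: vv'].
Qed.

Lemma gen_congruence_incl a b : R a b -> gen_congruence R a b.
Proof. by move=> Rab E _; apply. Qed.

Definition gen_congrb : rel S := fun u v => `[< gen_congruence R u v >].

Lemma gen_congrb_refl : reflexive gen_congrb.
Proof. by move=> u; apply/asboolP; apply: congr_refl gen_congruenceP _. Qed.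

Lemma gen_congrb_sym : symmetric gen_congrb.
Proof.
by move=> u v; apply/asboolP/asboolP; apply: congr_sym gen_congruenceP _ _.
Qed.

Lemma gen_congrb_trans : transitive gen_congrb.
Proof.
move=> v u w /asboolP uv /asboolP vw; apply/asboolP.
exact: congr_trans gen_congruenceP _ _ _ uv vw.
Qed.

Canonical gen_congr_equiv :=
  EquivRel gen_congrb gen_congrb_refl gen_congrb_sym gen_congrb_trans.

End SemigroupNotions.

Section Quotient.
Local Open Scope quotient_scope.
Variables (S : semigroupType) (R : S -> S -> Prop).

(* The quotient of S by the congruence generated by R; the class of u is
   \pi_(sgquot R) u *)
Definition sgquot := {eq_quot (gen_congr_equiv R)}.
HB.instance Definition _ := Choice.on sgquot.
HB.instance Definition _ := EqQuotient.on sgquot.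

Lemma sgquotP (u v : S) :
  \pi_sgquot u = \pi_sgquot v <-> gen_congruence R u v.
Proof. by split=> [/eqmodP/asboolP|uv]; last by apply/eqmodP/asboolP. Qed.

Definition sgquot_mul (a b : sgquot) : sgquot :=
  \pi_sgquot (repr a * repr b).

Lemma sgquot_mulE u v :
  sgquot_mul (\pi_sgquot u) (\pi_sgquot v) = \pi_sgquot (u * v).
Proof.
apply/sgquotP; apply: (congr_mul (gen_congruenceP R)).
- by apply/sgquotP; rewrite reprK.
- by apply/sgquotP; rewrite reprK.
Qed.

Lemma sgquot_mulA : associative sgquot_mul.
Proof.
move=> a b c; rewrite -[a]reprK -[b]reprK -[c]reprK.
by rewrite (sgquot_mulE (repr b)) (sgquot_mulE (repr a)) mulgA -!sgquot_mulE.
Qed.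

HB.instance Definition _ := isSemigroup.Build sgquot sgquot_mulA.

Lemma sgquot_piM u v :
  \pi_sgquot (u * v) = \pi_sgquot u * \pi_sgquot v.
Proof. by rewrite -sgquot_mulE. Qed.

End Quotient.

Section FreeSemigroup.
Variable T : choiceType.

Definition free_sg := {w : seq T | w != [::]}.
HB.instance Definition _ := SubChoice.on free_sg.

Definition letter (a : T) : free_sg := exist _ [:: a] isT.

Lemma free_sg_mul_subproof (u v : free_sg) : val u ++ val v != [::].
Proof. by case: u => -[]. Qed.

Definition free_sg_mul (u v : free_sg) : free_sg :=
  exist _ (val u ++ val v) (free_sg_mul_subproof u v).

Lemma free_sg_mulA : associative free_sg_mul.
Proof. by move=> u v w; apply: val_inj; rewrite /= catA. Qed.

HB.instance Definition _ := isSemigroup.Build free_sg free_sg_mulA.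

Lemma val_free_sgM (u v : free_sg) : val (u * v) = val u ++ val v.
Proof. by []. Qed.

End FreeSemigroup.

Inductive A : Type := A1 | Ax | Ax'.

Definition inv (a : A) : A :=
  match a with A1 => A1 | Ax => Ax' | Ax' => Ax end.

(* Elements of A and iterated 5-tuples (g^l, g^la, g^c, g^ra, g^r) *)
Inductive term : Type :=
| Sym (a : A)
| Tup (l : term) (la : A) (c : term) (ra : A) (r : term).

HB.instance Definition _ := gen_eqMixin term.
HB.instance Definition _ := gen_choiceMixin term.

(* The values of the projections on symbols are irrelevant *)
Definition tl t := if t is Tup l _ _ _ _ then l else t.
Definition tla t := if t is Tup _ la _ _ _ then la else A1.
Definition tc t := if t is Tup _ _ c _ _ then c else t.
Definition tra t := if t is Tup _ _ _ ra _ then ra else A1.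
Definition tr t := if t is Tup _ _ _ _ r then r else t.

Definition gxx' := Tup (Sym A1) A1 (Sym Ax) Ax' (Sym A1).

Fixpoint Ge (i : nat) : set term :=
  match i with
  | 0 => set0
  | 1 => [set gxx']
  | (_.+1 as j).+1 => [set h | exists2 g, Ge j g &
      h = Tup g (inv (tla g)) (tl g) (inv (tra g)) g \/
      h = Tup g (inv (tra g)) (tl g) (inv (tla g)) g]
  end.

Fixpoint Gd (i : nat) : set term :=
  match i with
  | ((_.+1 as k).+1 as j).+1 => [set g |
      match g with
      | Sym _ => False
      | Tup l la c ra r =>
        [/\ (Ge j `|` Gd j) l, (Ge k `|` Gd k) c & (Ge j `|` Gd j) r] /\
        [/\ l <> r,
            (c, la) = (tl l, inv (tla l)) \/ (c, la) = (tr l, inv (tra l)) &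
            (c, ra) = (tl r, inv (tla r)) \/ (c, ra) = (tr r, inv (tra r))]
      end]
  | _ => set0
  end.

Definition Gi (i : nat) : set term := Ge i `|` Gd i.

Definition G5 : set term := \bigcup_(i in [set i | 0 < i]) Gi i.

(* G'; this set and the full set G are called inG' and inG, the name G being
   reserved for the alphabet *)
Definition inG' : set term := G5 `|` [set Sym A1].

Definition inG : set term := G5 `|` range Sym.

(* By [heightE], height g is the i with g in G_i, and height 1 = 0; the values
   on x and x' are irrelevant *)
Fixpoint height (t : term) : nat :=
  if t is Tup l _ _ _ _ then (height l).+1 else 0.

Lemma heightE i g : Gi i g -> height g = i.
Proof.
elim/ltn_ind: i g => -[|[|[|i]]] IH g /=; do ?by case.
- by case=> //= ->.
- case=> //= -[h Gh [] -> /=].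
    by rewrite (IH 1%N) //; left.
  by rewrite (IH 1%N) //; left.
- case.
    by case=> h Gh [] -> /=; rewrite (IH i.+2) //; left.
  by case: g => // l la c ra r /= [[Gl _ _] _]; rewrite (IH i.+2).
Qed.

Lemma Gi_comp i g : Gi i.+1 g -> [/\ inG (tl g), inG (tc g) & inG (tr g)].
Proof.
elim/ltn_ind: i g => -[|i] IH g.
  by case=> //= ->; split; right; eexists.
case.
  case=> h Gh hE.
  have Gh5 : inG h by left; exists i.+1 => //; left.
  have [Ghl _ _] : [/\ inG (tl h), inG (tc h) & inG (tr h)].
    by apply: (IH i) => //; left.
  by case: hE => ->.
case: i IH => // i IH; case: g => // l la c ra r [[Gl Gc Gr] _].
by split; left; [exists i.+2|exists i.+1|exists i.+2].
Qed.

Lemma inG_comp g : inG g -> [/\ inG (tl g), inG (tc g) & inG (tr g)].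
Proof.
case=> [[[|i] // _ /Gi_comp//]|[a _ <-]].
by split; right; exists a.
Qed.

Definition G := {t : term | `[< inG t >]}.
HB.instance Definition _ := SubChoice.on G.

Lemma inG_sym a : `[< inG (Sym a) >].
Proof. by apply/asboolP; right; exists a. Qed.

Definition gsym (a : A) : G := exist _ (Sym a) (inG_sym a).

Lemma inG_gxx' : `[< inG gxx' >].
Proof. by apply/asboolP; left; exists 1%N => //; left. Qed.

Definition g_xx' : G := exist _ gxx' inG_gxx'.

Lemma inG_tl (g : G) : `[< inG (tl (val g)) >].
Proof. by apply/asboolP; case/asboolP/inG_comp: (valP g). Qed.

Lemma inG_tc (g : G) : `[< inG (tc (val g)) >].
Proof. by apply/asboolP; case/asboolP/inG_comp: (valP g). Qed.

Lemma inG_tr (g : G) : `[< inG (tr (val g)) >].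
Proof. by apply/asboolP; case/asboolP/inG_comp: (valP g). Qed.

Definition gl (g : G) : G := exist _ (tl (val g)) (inG_tl g).
Definition gla (g : G) : A := tla (val g).
Definition gc (g : G) : G := exist _ (tc (val g)) (inG_tc g).
Definition gra (g : G) : A := tra (val g).
Definition gr (g : G) : G := exist _ (tr (val g)) (inG_tr g).

Definition word := free_sg G.
HB.instance Definition _ := Semigroup.on word.

Definition wg (g : G) : word := letter g.
Definition wa (a : A) : word := letter (gsym a).

Definition gL (g : G) : word := wa (inv (gla g)) * wg (gl g) * wa (gla g).
Definition gR (g : G) : word := wa (inv (gra g)) * wg (gr g) * wa (gra g).

Definition tall (g : G) := G5 (val g) /\ 2 <= height (val g).

Inductive rho_pair : word -> word -> Prop :=
| rho_x : rho_pair (wa Ax * wa Ax' * wa Ax) (wa Ax)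
| rho_x' : rho_pair (wa Ax' * wa Ax * wa Ax') (wa Ax')
| rho_gxx' : rho_pair (wg g_xx') (wa Ax * wa Ax')
| rho_1g (g : G) : rho_pair (wa A1 * wg g) (wg g)
| rho_g1 (g : G) : rho_pair (wg g * wa A1) (wg g)
| rho_gg (g : G) : inG' (val g) -> rho_pair (wg g * wg g) (wg g)
| rho_L (g : G) : tall g -> rho_pair (wg (gc g) * gL g * wg g) (wg g)
| rho_R (g : G) : tall g -> rho_pair (wg g * gR g * wg (gc g)) (wg g)
| rho_LR (g : G) : tall g -> rho_pair
    (wg (gr g) * wa (gra g) * wg g * wa (inv (gla g)) * wg (gl g))
    (wg (gr g) * wa (gra g) * wg (gc g) * wa (inv (gla g)) * wg (gl g)).

Definition F11 := sgquot rho_pair.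
HB.instance Definition _ := Semigroup.on F11.
HB.instance Definition _ := EqQuotient.on F11.

Definition cls (u : word) : F11 := (\pi_F11 u)%qT.

Lemma clsM u v : cls (u * v) = cls u * cls v.
Proof. exact: sgquot_piM. Qed.

Lemma clsP u v : cls u = cls v <-> gen_congruence rho_pair u v.
Proof. exact: sgquotP. Qed.

Lemma cls_surj (s : F11) : exists u, s = cls u.
Proof. by exists (repr s); rewrite /cls reprK. Qed.

Lemma cls_pair u v : rho_pair u v -> cls u = cls v.
Proof. by move=> uv; apply/clsP => E _; apply. Qed.

Lemma word_ind (P : word -> Prop) :
  (forall g, P (wg g)) -> (forall g u, P u -> P (wg g * u)) -> forall u, P u.
Proof.
move=> Pg PM u; case: u => -[//|g w].
elim: w g => [|h w IH] g w0.
  by have := Pg g; congr P; apply: val_inj.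
by have := PM g _ (IH h isT); congr P; apply: val_inj.
Qed.

Lemma F11_mul1g : left_id (cls (wa A1)) mul.
Proof.
move=> s; have [u ->] := cls_surj s; rewrite -clsM.
elim/word_ind: u => [g|g u _]; first exact/cls_pair/rho_1g.
by rewrite mulgA (clsM (wa A1 * wg g)) (cls_pair (rho_1g g)) -clsM.
Qed.

Lemma F11_mulg1 : right_id (cls (wa A1)) mul.
Proof.
move=> s; have [u ->] := cls_surj s; rewrite -clsM.
elim/word_ind: u => [g|g u IH]; first exact/cls_pair/rho_g1.
by rewrite -mulgA !(clsM (wg g)) IH.
Qed.

HB.instance Definition _ := Semigroup_isMonoid.Build F11 F11_mul1g F11_mulg1.

Definition all1 (u : word) := all (pred1 (gsym A1)) (val u).

Lemma all1M u v : all1 (u * v) = all1 u && all1 v.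
Proof. by rewrite /all1 all_cat. Qed.

Lemma tall_neq1 g : tall g -> (g == gsym A1) = false.
Proof. by move=> [_ h]; apply/eqP => gE; rewrite gE in h. Qed.

Lemma tall_gr_neq1 g : tall g -> (gr g == gsym A1) = false.
Proof.
move=> [[i _ Gg] h]; apply/eqP => E.
have {}E : tr (val g) = Sym A1 := congr1 val E.
move: h; rewrite (heightE Gg); case: i Gg => [|[|i]] // [].
  case=> k Gk gE _; have kE : tr (val g) = k by case: gE => ->.
  have : height k = i.+1 by apply: heightE; left.
  by rewrite -kE E.
case: i => // i; case: (val g) E => // l la c ra r rE [[_ _ Gr] _] _.
by have := @heightE i.+2 r Gr; rewrite (rE : r = _).
Qed.

Lemma all1_wa a : all1 (wa a) = (gsym a == gsym A1).
Proof. by rewrite /all1 /= andbT. Qed.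

Lemma all1_wg g : all1 (wg g) = (g == gsym A1).
Proof. by rewrite /all1 /= andbT. Qed.

Lemma gsym_eq a : (gsym a == gsym A1) = if a is A1 then true else false.
Proof. by case: a; apply/eqP => // /(congr1 val). Qed.

Lemma all1_cls u v : cls u = cls v -> all1 u = all1 v.
Proof.
move/clsP/(_ (fun u v => all1 u = all1 v)); apply; first split=> //.
- by move=> ? ? ? ->.
- by move=> a a' b b' ha hb; rewrite !all1M ha hb.
move=> {u v} _ _ []; rewrite /gL /gR; do ?[by move=> *;
  rewrite !all1M ?all1_wa ?all1_wg ?eqxx ?andbb ?andbT ?gsym_eq].
- by rewrite !all1M all1_wa all1_wg gsym_eq; apply/eqP => /(congr1 val).
- by move=> g gt; rewrite !all1M !all1_wg (tall_neq1 gt) !andbF.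
- by move=> g gt; rewrite !all1M !all1_wg (tall_neq1 gt).
- by move=> g gt; rewrite !all1M !all1_wg (tall_gr_neq1 gt).
Qed.

Lemma cls_eq1 u : (cls u == 1) = all1 u.
Proof.
apply/eqP/idP => [/all1_cls->|]; first by rewrite all1_wa.
elim/word_ind: u => [g|g u IH]; rewrite ?all1M all1_wg.
  by move/eqP->.
by case/andP=> /eqP-> /IH; rewrite clsM => ->; rewrite mulg1.
Qed.

Lemma F11_neq1_mulg_closed : mulg_closed [pred s : F11 | s != 1].
Proof.
move=> s t; have [u ->] := cls_surj s; have [v ->] := cls_surj t.
by rewrite !inE -clsM !cls_eq1 all1M negb_and => ->.
Qed.

Definition F1 := {s : F11 | s != 1}.
HB.instance Definition _ := SubChoice.on F1.
HB.instance Definition _ := SubChoice_isSubSemigroup.Build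
  F11 [pred s : F11 | s != 1] F1 F11_neq1_mulg_closed.

Lemma cls_x_neq1 : cls (wa Ax) != 1.
Proof. by rewrite cls_eq1 all1_wa gsym_eq. Qed.

Definition F1_x : F1 := exist _ (cls (wa Ax)) cls_x_neq1.

(* Main.v *)
From HB Require Import structures.
From mathcomp Require Import all_boot.
From mathcomp Require Import boolp classical_sets.
Require Import Defs.

(** Letters of G^5 are treated as vertices of a graph in which [g] lies above
    its components g^l and g^r, each edge carrying a label; a word is then a
    closed walk at 1. The defining relations say that going down an edge and up
    the same edge is trivial, and that a valley g^r, g^c, g^l with two distinct
    edges can be lifted to the peak g^r, g, g^l. The recursive definition of G^5
    is made so that every such valley can be lifted, and so that all letters but
    [gxx'] arise in this way ([peak_G5], [G5P]). Lifting and cancelling valleys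
    turns every walk into a mountain, that is, an ascent followed by a descent.

    Instead of proving confluence of this rewriting, moves along edges are made
    to act on mountains ([up], [act]). The two kinds of valley are removed by
    the very definition of the action, so the relations of the presentation are
    easily seen to hold ([word_walk_cls]). The action is faithful on [F11],
    because the class of a word is the value of the mountain that the word makes
    of the empty one ([cls_normal], [cls_acteq]).

    Regularity: the reverse of a mountain is an inverse of it ([F11_regular]).

    Minimality: the action never shortens the ascent of a mountain. If
    s = g^r g^ra g^c (g^la)' g^l, whose mountain has its peak at [g], and if
    s t s = s, then t acts after s without ever lengthening the ascent. This
    leaves so little freedom ([act_loop]) that
    g^c (g^la)' g^l t g^r g^ra g^c = g in [F11] ([preinverse_peak]). In the same
    way x' is the only t with x t x = x ([preinverse_x]). Hence a regular
    subsemigroup that contains x contains x', and then, by induction on the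
    height, every letter ([generation]). *)

Set Implicit Arguments.
Unset Strict Implicit.
Unset Printing Implicit Defensive.

Local Open Scope classical_set_scope.
Local Open Scope group_scope.

(** * Edges and peaks of the alphabet *)

(** The edge [(q, false)] joins [q] to [tl q], the edge [(q, true)] joins it to
    [tr q]; keeping the side distinguishes the two edges between [q] and
    [tl q] when [tl q = tr q]. *)
Local Notation edge := (term * bool)%type.

Definition child (e : edge) : term := if e.2 then tr e.1 else tl e.1.
Definition lab (e : edge) : A := if e.2 then tra e.1 else tla e.1.

(** The letter [g] for which g^r g^ra g^c (g^la)' g^l is the valley that goes
    down along [f] and up again along [e]. *)
Definition peak (f e : edge) : term :=
  Tup e.1 (inv (lab e)) (child e) (inv (lab f)) f.1.

Lemma invK : involutive inv.
Proof. by case. Qed.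

(** On the letters with equal left and right components, the labels still tell
    the two edges apart: this is why edges are determined by their lower end
    and their label, on all of G^5. *)
Lemma Ge_twin i g : Ge i g -> tl g = tr g /\ tla g <> tra g.
Proof.
elim: i g => [//|[_ g ->//|i] IH] g [h /IH[_ neq] [->|->]]; split=> //=.
  by move/(can_inj invK).
by move/(can_inj invK)/esym.
Qed.

Lemma Gd_neq i g : Gd i g -> tl g <> tr g.
Proof. by case: i => [|[|[|i]]] //; case: g => // l la c ra r [_ []]. Qed.

Lemma G5_height g : G5 g -> (0 < height g)%N /\ Gi (height g) g.
Proof. by case=> i i0 Gg; rewrite (heightE Gg). Qed.

Lemma Gi_G5 i g : Gi i.+1 g -> G5 g.
Proof. by exists i.+1. Qed.

Lemma G5_twin q : G5 q -> tl q = tr q -> tla q <> tra q.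
Proof. by case=> i _ [/Ge_twin[]//|/Gd_neq]. Qed.

Lemma child_level e i : Gi i.+1 e.1 ->
  if i is 0 then child e = Sym A1 else Gi i (child e).
Proof.
case: e => q s; rewrite /child /=; case: i => [|i].
  by case=> //= ->; case: s.
case.
  by case=> h Gh [] ->; case: s => /=; left.
case: i => // i; case: q => // l la c ra r [[Gl _ Gr] _].
by case: s.
Qed.

Lemma child_inG' e : G5 e.1 -> inG' (child e).
Proof.
case=> -[//|i _ /child_level]; case: i => [->|i /Gi_G5]; [by right|by left].
Qed.

Lemma height_child e : G5 e.1 -> height e.1 = (height (child e)).+1.
Proof.
case=> -[//|i _ Ge1]; rewrite (heightE Ge1).
by case: i Ge1 => [|i] /child_level => [->//|/heightE->].
Qed.

(** G^5 is generated from [gxx'] by peaks over valleys with two distinct edges: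
    the letters of [Gd] sit over valleys with distinct ends, and those of [Ge]
    over valleys that descend and return between the same two letters. *)
Lemma peak_G5 f e : G5 e.1 -> G5 f.1 -> child e = child f -> e <> f ->
  G5 (peak f e).
Proof.
move=> Ge Gf cE ef.
have hef : height e.1 = height f.1 by rewrite !height_child // cE.
have [h0 Le] := G5_height Ge; have [_] := G5_height Gf; rewrite -hef => Lf.
case hE: (height e.1) h0 Le Lf => [//|i] _ Le Lf.
have [tE|tN] := pselect (e.1 = f.1).
  apply: (@Gi_G5 i.+1); left; exists e.1.
    case: Le => // /Gd_neq; case; case: (e) (f) ef cE tE => q [] [q' []] //=.
    - by move=> + _ qE; rewrite qE.
    - by rewrite /child /= => _ -> ->.
    - by rewrite /child /= => _ -> ->.
    - by move=> + _ qE; rewrite qE.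
  rewrite /peak; case: (e) (f) ef cE tE => q [] [q' []] /=.
  - by move=> + _ qE; rewrite qE.
  - by rewrite /child /lab /= => _ -> ->; right.
  - by rewrite /child /lab /= => _ _ ->; left.
  - by move=> + _ qE; rewrite qE.
case: i hE Le Lf => [|i] hE Le Lf.
  by case: Le Lf tN => //= -> [] //= ->.
apply: (@Gi_G5 i.+2); right; split.
  by split=> //; exact: (child_level Le).
split=> //.
- by case: (e) => q [] /=; [right|left].
- by rewrite cE; case: (f) => q [] /=; [right|left].
Qed.

Lemma G5P g : G5 g -> g = gxx' \/ exists e f : edge,
  [/\ G5 e.1, G5 f.1, child e = child f, e <> f & g = peak f e].
Proof.
case=> -[//|[_ [->|//]|i _ [[h Gh hE]|]]]; first by left.
  have {}Gh : Ge i.+1 h := Gh.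
  have [tE _] := Ge_twin Gh; have Gh5 : G5 h by apply: (@Gi_G5 i); left.
  right; case: hE => ->.
    by exists (h, false), (h, true); split.
  by exists (h, true), (h, false); rewrite /peak /child /= tE.
case: i => // i; case: g => // l la c ra r [[Gl _ Gr] [lr lE rE]]; right.
have {}lE : exists s, c = child (l, s) /\ la = inv (lab (l, s)).
  by case: lE => -[-> ->]; [exists false|exists true].
have {}rE : exists s, c = child (r, s) /\ ra = inv (lab (r, s)).
  by case: rE => -[-> ->]; [exists false|exists true].
case: lE rE => s [cl ->] [s' [cr ->]].
exists (l, s), (r, s'); split=> //; rewrite /peak /= -?cl //.
- exact: (@Gi_G5 i.+1).
- exact: (@Gi_G5 i.+1).
- by case.
Qed.

Lemma G5_gxx' : G5 gxx'.
Proof. by apply: (@Gi_G5 0); left. Qed.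

Lemma inG'_G5 t : G5 t -> inG' t.
Proof. by left. Qed.

Lemma inG_cases t : inG t -> [\/ inG' t, t = Sym Ax | t = Sym Ax'].
Proof.
case=> [Gt|[[] _ <-]]; first by apply: Or31; left.
- by apply: Or31; right.
- exact: Or32.
- exact: Or33.
Qed.

Lemma inG_val (g : G) : inG (val g).
Proof. by apply/asboolP; exact: valP g. Qed.

Lemma inG'_ind (P : term -> Prop) :
    P (Sym A1) -> P gxx' ->
    (forall e f : edge, G5 e.1 -> G5 f.1 -> child e = child f -> e <> f ->
       P e.1 -> P f.1 -> P (child e) -> P (peak f e)) ->
  forall g, inG' g -> P g.
Proof.
move=> P0 P1 P2 g Gg; have [n] := ubnP (height g).
elim: n g Gg => // n IH g [/G5P[->//|[e [f [Ge Gf cE ef ->]]]]|->//] /=.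
rewrite ltnS => lt_n; have Gc := child_inG' Ge.
have he := height_child Ge; have hf := height_child Gf; rewrite -cE -he in hf.
apply: P2 => //; apply: IH => //; do ?by left.
- by rewrite hf.
- by apply: leq_trans lt_n; rewrite he ltnS leqW.
Qed.

(** * The action of moves on states *)

Inductive move := Up of edge | Dn of edge.

(** A state [(a, d)] stands for a walk that climbs from 1 along [a] and then
    descends along [d]; the most recent edge is the head of each list. No
    condition is put on the edges, so that moves act on every state. *)
Definition state : Type := (seq edge * seq edge)%type.

(** Climbing [e] at the end of a descent [f :: d]: either [e] undoes [f], or the
    valley is replaced by its peak, whose ascending edge now has to be absorbed
    by the rest of the descent. *)
Fixpoint up (e : edge) (a d : seq edge) : state :=
  if d is f :: d' then
    if e == f then (a, d') else
    let s := up (peak f e, true) a d' in (s.1, (peak f e, false) :: s.2)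
  else (e :: a, [::]).

Definition step (s : state) (m : move) : state :=
  match m with Up e => up e s.1 s.2 | Dn e => (s.1, e :: s.2) end.

Definition act : state -> seq move -> state := foldl step.

Definition acteq (m n : seq move) := forall s, act s m = act s n.

Lemma act_cat s m n : act s (m ++ n) = act (act s m) n.
Proof. exact: foldl_cat. Qed.

Lemma acteq_cat m m' n n' :
  acteq m m' -> acteq n n' -> acteq (m ++ n) (m' ++ n').
Proof. by move=> mm' nn' s; rewrite !act_cat mm' nn'. Qed.

Lemma acteq_pop e : acteq [:: Dn e; Up e] [::].
Proof. by case=> a d; rewrite /= eqxx. Qed.

Lemma acteq_peak f e : e <> f ->
  acteq [:: Dn f; Up e] [:: Up (peak f e, true); Dn (peak f e, false)].
Proof. by move=> /eqP/negbTE ef [a d]; rewrite /= ef. Qed.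

Definition moves (s : state) : seq move :=
  map Up (rev s.1) ++ map Dn (rev s.2).

Lemma moves_dn a f d : moves (a, f :: d) = moves (a, d) ++ [:: Dn f].
Proof. by rewrite /moves /= rev_cons map_rcons -cats1 catA. Qed.

Lemma moves_up e a : moves (e :: a, [::]) = moves (a, [::]) ++ [:: Up e].
Proof. by rewrite /moves /= !cats0 rev_cons map_rcons -cats1. Qed.

(** Computing the state of a walk uses only steps that leave the action
    unchanged. *)
Lemma moves_step s m : acteq (moves (step s m)) (moves s ++ [:: m]).
Proof.
case: s => a d; case: m => e t; last by rewrite moves_dn.
rewrite /=; elim: d e t => [|f d IH] e t; first by rewrite moves_up.
rewrite /= moves_dn -catA act_cat; have [->|/eqP ef] := eqVneq e f.
  by rewrite acteq_pop.
by rewrite acteq_peak // moves_dn -surjective_pairing act_cat IH act_cat.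
Qed.

Lemma moves_act m : acteq (moves (act ([::], [::]) m)) m.
Proof.
elim/last_ind: m => [//|m x IH] s; rewrite -cats1 act_cat moves_step act_cat.
by rewrite IH act_cat.
Qed.

(** An ascent changes only when a climb reaches it, and then it grows; a
    computation that returns to the same ascent has thus never touched it. *)
Lemma up_size e a d : (size a <= size (up e a d).1)%N.
Proof. by elim: d e => [|f d IH] e //=; case: eqP => //= _; exact: IH. Qed.

Lemma act_size s m : (size s.1 <= size (act s m).1)%N.
Proof.
elim: m s => //= m ms IH s; apply: leq_trans (IH _).
by case: m => // e; exact: up_size.
Qed.

Lemma up_top e f a : (size (up e a [:: f]).1 <= size a)%N -> e = f.
Proof. by rewrite /=; case: eqP => //= _; rewrite ltnn. Qed.

Lemma act_dn s l : act s (map Dn l) = (s.1, rev l ++ s.2).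
Proof.
elim: l s => [|e l IH] [a d] //=.
by rewrite IH /= rev_cons cat_rcons.
Qed.

Lemma act_up a l : act (a, [::]) (map Up l) = (rev l ++ a, [::]).
Proof. by elim: l a => [|e l IH] a //=; rewrite IH rev_cons cat_rcons. Qed.

(** If descending [e], walking [m] and climbing [f] leaves a pure ascent
    unchanged, then no step can have lengthened that ascent, and this leaves a
    single possibility for the normal form of [m]. This is the rigidity from
    which the minimality of [F1] follows. *)
Lemma act_loop (e f : edge) a m : e <> f ->
    act (a, [::]) ([:: Dn e] ++ m ++ [:: Up f]) = (a, [::]) ->
  acteq m [:: Up e; Dn f].
Proof.
move=> ef; rewrite !act_cat [act _ [:: Dn e]]/=.
have := act_size (a, [:: e]) m.
case E: (act (a, [:: e]) m) => [a' d'].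
case: d' E => [|f' d'] E /=.
  by move=> sa [aE]; rewrite -aE ltnn in sa.
move=> _; case: eqP => [fE [aE dE]|//].
subst f' a' d' => s.
(* The normal form [(u, d)] of [m] can be run in place of [m]. *)
rewrite -(moves_act m) /moves.
have := moves_act m (a, [:: e]); rewrite E /moves.
case: (act _ m) => /= u d; rewrite act_cat act_dn revK.
case: {u}(rev u) => [|e' u] /=.
  by case: d => [[/ef]|? []//].
case=> aE dE; have e'E : e' = e.
  apply: (@up_top e' e a); rewrite -[X in (_ <= size X)%N]aE.
  exact: act_size.
move: aE dE; rewrite {}e'E eqxx act_up cats0 /= => aE ->.
move/(congr1 size)/eqP: aE; rewrite size_cat -[X in _ == X]add0n eqn_add2r.
by rewrite size_rev => /nilP->.
Qed.

(** * Words as walks *)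

Lemma peak_edges f e :
  (child (peak f e, false) = e.1) * (lab (peak f e, false) = inv (lab e)) *
  (child (peak f e, true) = f.1) * (lab (peak f e, true) = inv (lab f)).
Proof. by []. Qed.

(** Recovers an edge from its two ends and its label; testing the left one first
    is harmless, as [G5_twin] excludes that both edges qualify. *)
Definition side (q c : term) (a : A) : edge :=
  (q, ~~ `[< tl q = c /\ tla q = a >]).

Lemma sideE e : G5 e.1 -> side e.1 (child e) (lab e) = e.
Proof.
case: e => q s /= Gq; congr pair; rewrite /child /lab /=.
case: s => /=; last by apply/negbTE/negPn/asboolP.
by apply/asboolPn => -[/(G5_twin Gq)].
Qed.

(** A letter [t] stands for a closed walk at 1 through [t]. It reaches [t] from
    [tc t], two levels below, through [tl t], and returns to [tc t] through
    [tr t]: this reads the equations g = g^c g^L g = g g^R g^c. *)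
Fixpoint climb (t : term) : seq edge :=
  if t is Tup l la c _ _ then
    (if l is Tup _ _ _ _ _ then climb c ++ [:: side l c (inv la)] else [::])
    ++ [:: (t, false)]
  else [::].

Fixpoint descent (t : term) : seq edge :=
  if t is Tup _ _ c ra r then
    if r is Tup _ _ _ _ _ then
      [:: (t, true), side r c (inv ra) & descent c]
    else [:: (t, false)]
  else [::].

Definition ups t := map Up (climb t).
Definition dns t := map Dn (descent t).

Lemma G5_tup g : G5 g -> exists l la c ra r, g = Tup l la c ra r.
Proof.
by case/G5P=> [->|[e [f [_ _ _ _ ->]]]]; do 5!eexists; reflexivity.
Qed.

Lemma ups_peak f e : G5 e.1 ->
  ups (peak f e) = ups (child e) ++ [:: Up e; Up (peak f e, false)].
Proof.
move=> Ge; have := sideE Ge; have [l [la [c [ra [r eE]]]]] := G5_tup Ge.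
by rewrite /ups /peak /= invK eE -catA map_cat => /= ->.
Qed.

Lemma dns_peak f e : G5 f.1 -> child e = child f ->
  dns (peak f e) = [:: Dn (peak f e, true), Dn f & dns (child e)].
Proof.
move=> Gf cE; have := sideE Gf; have [l [la [c [ra [r fE]]]]] := G5_tup Gf.
by rewrite /dns /peak /= invK cE fE => /= ->.
Qed.

(** As the letter [gxx'] is [xx'], the letters x and x' cross it from one side
    to the other. *)
Definition walk (t : term) : seq move :=
  match t with
  | Sym Ax => [:: Up (gxx', false); Dn (gxx', true)]
  | Sym Ax' => [:: Up (gxx', true); Dn (gxx', false)]
  | _ => ups t ++ dns t
  end.

Definition word_walk (w : word) : seq move :=
  flatten [seq walk (val g) | g <- val w].

Lemma word_walkM u v : word_walk (u * v) = word_walk u ++ word_walk v.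
Proof. by rewrite /word_walk val_free_sgM map_cat flatten_cat. Qed.

Lemma word_walk_wg g : word_walk (wg g) = walk (val g).
Proof. exact: cats0. Qed.

Lemma word_walk_wa a : word_walk (wa a) = walk (Sym a).
Proof. exact: cats0. Qed.

Lemma walk_G' t : inG' t -> walk t = ups t ++ dns t.
Proof. by case=> [/G5_tup[l [la [c [ra [r ->]]]]]|->]. Qed.

Lemma act_pop e s : step (step s (Dn e)) (Up e) = s.
Proof. exact: (acteq_pop e s). Qed.

Lemma act_peak f e s : e <> f ->
  step (step s (Dn f)) (Up e) =
  step (step s (Up (peak f e, true))) (Dn (peak f e, false)).
Proof. by move=> ef; exact: (acteq_peak ef s). Qed.

Lemma act_ups f e s : G5 e.1 -> act s (ups (peak f e)) =
  step (step (act s (ups (child e))) (Up e)) (Up (peak f e, false)).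
Proof. by move=> Ge; rewrite ups_peak // act_cat. Qed.

Lemma act_dns f e s : G5 f.1 -> child e = child f ->
  act s (dns (peak f e)) =
  act (step (step s (Dn (peak f e, true))) (Dn f)) (dns (child e)).
Proof. by move=> Gf cE; rewrite dns_peak. Qed.

Lemma dns_ups g s : inG' g -> act (act s (dns g)) (ups g) = s.
Proof.
move=> Gg; elim/inG'_ind: g / Gg s => [//|s|]; first exact: act_pop.
move=> e f Ge Gf cE ef _ _ IH s.
by rewrite act_dns // act_ups // IH act_peak // !act_pop.
Qed.

Definition edge_walk (e : edge) : Prop := forall s,
  act (act (act s (dns (child e))) (walk (Sym (lab e)))) (ups e.1)
    = step s (Up e) /\
  act (act (act s (dns e.1)) (walk (Sym (inv (lab e))))) (ups (child e))
    = step s (Dn e).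

(** In the closed walk of a letter followed by a label and by the closed walk of
    a neighbouring letter, everything between the two letters amounts to the
    edge that joins them. *)
Lemma edge_walkP e : G5 e.1 -> edge_walk e.
Proof.
suff W : forall g, inG' g -> G5 g -> forall b, edge_walk (g, b).
  by case: e => g b /= Gg; apply: W => //; left.
move=> {e} g G'g; elim/inG'_ind: g / G'g => [/G5_height[]//|_ [] s|].
- split; first exact: (act_pop (gxx', false)).
  exact: (congr1 (step^~ (Dn (gxx', true))) (act_pop (gxx', false) s)).
- by [].
move=> e f Ge Gf cE ef IHe IHf _ _ b s.
have We : edge_walk e by case: (e) Ge IHe => q c /= Gq /(_ Gq c).
have Wf : edge_walk f by case: (f) Gf IHf => q c /= Gq /(_ Gq c).
rewrite /edge_walk -cE in Wf.
have U := act_ups f _ Ge; have D := act_dns _ Gf cE.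
split; case: b; rewrite !peak_edges ?invK ?U ?D.
- by rewrite (Wf _).2 act_peak // act_pop.
- by rewrite (We _).2 act_pop.
- by rewrite (Wf _).1 act_pop.
- by rewrite (We _).1 act_peak // act_pop.
Qed.

Arguments step : simpl never.
Arguments walk : simpl never.

Lemma tallP g : tall g -> exists e f : edge,
  [/\ G5 e.1, G5 f.1, child e = child f, e <> f & val g = peak f e].
Proof. by case=> /G5P[->//|[e [f ?]]] _; exists e, f. Qed.

Lemma act_walk t s : inG' t -> act s (walk t) = act (act s (ups t)) (dns t).
Proof. by move=> /walk_G'->; rewrite act_cat. Qed.

(** Adjacent closed walks collapse to single edges by [edge_walkP]. After that
    the relations for g^L and g^R describe the closed walk of g, and the last
    relation is a step of the action. *)
Lemma word_walk_cls u v : cls u = cls v -> acteq (word_walk u) (word_walk v).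
Proof.
move/clsP/(_ (fun u v => acteq (word_walk u) (word_walk v))); apply.
  split=> [//|a b ab s|a b c ab bc s|a a' b b' aa' bb'].
  - by rewrite ab.
  - by rewrite ab bc.
  - by rewrite !word_walkM; exact: acteq_cat.
move=> {u v} _ _ [||| g | g | g Gg | g gt | g gt | g gt] s;
  rewrite /gL /gR !word_walkM !word_walk_wg ?word_walk_wa !act_cat.
- by rewrite /walk /act /= !act_pop.
- by rewrite /walk /act /= !act_pop.
- by rewrite /walk /act /= !act_pop.
- by [].
- by [].
- by rewrite !act_walk // dns_ups.
all: have [e [f [Ge Gf cE ef gE]]] := tallP gt.
all: have Gp : G5 (peak f e) by rewrite -gE; case: gt.
all: have [[GE GF] GP] := (inG'_G5 Ge, inG'_G5 Gf, inG'_G5 Gp).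
all: have Gc := child_inG' Ge.
all: have [We Wf] := (edge_walkP Ge, edge_walkP Gf).
all: rewrite /edge_walk -cE in Wf.
all: have U := act_ups f _ Ge; have D := act_dns _ Gf cE.
all: have Wl := edge_walkP (e := (peak f e, false)) Gp.
all: rewrite /edge_walk !peak_edges invK [(_, _).1]/= in Wl.
all: have Wr := edge_walkP (e := (peak f e, true)) Gp.
all: rewrite /edge_walk !peak_edges invK [(_, _).1]/= in Wr.
all: rewrite /gla /gra /= gE /= ?invK -/(peak f e).
all: rewrite !(act_walk _ Gc, act_walk _ GE, act_walk _ GF, act_walk _ GP).
- by rewrite (We _).1 (Wl _).1 U.
- by rewrite (Wr _).2 (Wf _).2 D.
- by rewrite (Wr _).1 (Wl _).2 (Wf _).2 (We _).1 act_peak.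
Qed.

(** * Normal forms in [F11] *)

(** Defined on all terms, since edges and walks are made of plain terms; the
    default value is never met on letters. *)
Definition elt (t : term) : F11 :=
  if insub t is Some g then cls (wg g) else 1.

Lemma elt_val (g : G) : elt (val g) = cls (wg g).
Proof. by rewrite /elt valK. Qed.

Lemma elt_sym a : elt (Sym a) = cls (wa a).
Proof. exact: elt_val (gsym a). Qed.

Lemma elt1 : elt (Sym A1) = 1.
Proof. exact: elt_sym. Qed.

Lemma inG'_ex t : inG' t -> exists g : G, val g = t.
Proof.
move=> Gt; suff Pt : `[< inG t >] by exists (exist _ t Pt).
by apply/asboolP; case: Gt => [|->]; [left|right; exists A1].
Qed.

Lemma elt_idem t : inG' t -> elt t * elt t = elt t.
Proof.
move=> Gt; have [g gE] := inG'_ex Gt; rewrite -gE elt_val -clsM.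
by apply/cls_pair/rho_gg; rewrite gE.
Qed.

Lemma peak_ex f e : G5 e.1 -> G5 f.1 -> child e = child f -> e <> f ->
  exists2 g : G, tall g & val g = peak f e.
Proof.
move=> Ge Gf cE ef; have Gp := peak_G5 Ge Gf cE ef.
have [g gE] := inG'_ex (inG'_G5 Gp); exists g => //; split; rewrite gE //=.
by have [] := G5_height Ge.
Qed.

Definition move_val (m : move) : F11 :=
  match m with
  | Up e => elt (Sym (lab e)) * elt e.1
  | Dn e => elt (Sym (inv (lab e))) * elt (child e)
  end.

Definition walk_val (ms : seq move) : F11 :=
  foldr (fun m s => move_val m * s) 1 ms.

Lemma walk_val_cat m n : walk_val (m ++ n) = walk_val m * walk_val n.
Proof. by elim: m => [|x m IH] /=; rewrite ?mul1g // IH mulgA. Qed.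

Section Peak.
Variables e f : edge.
Hypotheses (Ge : G5 e.1) (Gf : G5 f.1) (cE : child e = child f) (ef : e <> f).

Let peak_exE := peak_ex Ge Gf cE ef.

Lemma elt_peakl :
  elt (child e) * move_val (Up e) * move_val (Up (peak f e, false)) =
  elt (peak f e).
Proof.
case: peak_exE => g gt gE; have := cls_pair (rho_L gt).
rewrite /gL !clsM -!elt_val /gla /= gE /= invK.
by rewrite -/(peak f e) !mulgA.
Qed.

Lemma elt_peakr :
  elt (peak f e) * move_val (Dn (peak f e, true)) * move_val (Dn f) =
  elt (peak f e).
Proof.
case: peak_exE => g gt gE; have := cls_pair (rho_R gt).
rewrite /gR !clsM -!elt_val /gra /= gE /= !invK -cE.
by rewrite -/(peak f e) !mulgA.
Qed.

Lemma elt_peakC :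
  elt f.1 * move_val (Dn f) * move_val (Up e) =
  elt f.1 * move_val (Up (peak f e, true)) * move_val (Dn (peak f e, false)).
Proof.
case: peak_exE => g gt gE; have := cls_pair (rho_LR gt).
rewrite !clsM -!elt_val /gla /gra /= gE /= !invK -cE.
by rewrite -/(peak f e) !mulgA => ->.
Qed.

Lemma elt_childl : elt (child e) * elt (peak f e) = elt (peak f e).
Proof. by rewrite -elt_peakl !mulgA (elt_idem (child_inG' Ge)). Qed.

Lemma elt_childr : elt (peak f e) * elt (child e) = elt (peak f e).
Proof.
by rewrite -elt_peakr -!mulgA /= -cE (elt_idem (child_inG' Ge)).
Qed.

End Peak.

Lemma elt_gxx' : elt gxx' = elt (Sym Ax) * elt (Sym Ax').
Proof.
by rewrite !elt_sym -clsM -(cls_pair rho_gxx') -elt_val.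
Qed.

Lemma elt_xx'x : elt (Sym Ax) * elt (Sym Ax') * elt (Sym Ax) = elt (Sym Ax).
Proof. by rewrite !elt_sym -!clsM; exact/cls_pair/rho_x. Qed.

Lemma elt_x'xx' : elt (Sym Ax') * elt (Sym Ax) * elt (Sym Ax') = elt (Sym Ax').
Proof. by rewrite !elt_sym -!clsM; exact/cls_pair/rho_x'. Qed.

(** For a left edge of [q], when [q] is not [gxx'], multiply the equation
    q^c q^L q = q by [q] on the left, where q q^c = q; right edges are dual. *)
Lemma elt_pop e : G5 e.1 ->
  elt e.1 * move_val (Dn e) * move_val (Up e) = elt e.1.
Proof.
case: e => q s /= Gq; have qq := elt_idem (inG'_G5 Gq).
case: (G5P Gq) => [qE|[e [f [Ge Gf cE ef qE]]]]; subst q.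
  case: s; rewrite /move_val /lab /child /= elt1 ?mul1g ?mulg1 ?qq //.
  by rewrite elt_gxx' !mulgA !elt_xx'x.
case: s; rewrite /= !peak_edges !invK !mulgA.
  rewrite -[X in _ * X](elt_childl Ge Gf cE ef).
  by have := elt_peakr Ge Gf cE ef; rewrite /= peak_edges invK -cE !mulgA => ->.
rewrite -[X in X * _ * _ * _ * _](elt_childr Ge Gf cE ef).
have := elt_peakl Ge Gf cE ef; rewrite /= !peak_edges !mulgA => E.
by rewrite -!(mulgA (elt (peak f e))) E.
Qed.

(** By g^c g^L g = g, climbing two levels at a time from 1 to [q] always yields
    the letter that has been reached. *)
Lemma walk_val_ups q : inG' q -> walk_val (ups q) = elt q.
Proof.
move=> Gq; elim/inG'_ind: q / Gq => [||e f Ge Gf cE ef _ _ IH].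
- by rewrite elt1.
- by rewrite /= !elt1 mul1g mulg1.
rewrite ups_peak // walk_val_cat IH.
by rewrite -(elt_peakl Ge Gf cE ef) /= mulg1 !mulgA.
Qed.

Lemma walk_val_dns q : inG' q -> elt q * walk_val (dns q) = elt q.
Proof.
move=> Gq; elim/inG'_ind: q / Gq => [||e f Ge Gf cE ef _ _ IH].
- by rewrite elt1 mulg1.
- by rewrite /= !elt1 mul1g !mulg1.
have E := elt_peakr Ge Gf cE ef; have C := elt_childr Ge Gf cE ef.
rewrite dns_peak // [walk_val _]/= -/(walk_val _) [LHS]mulgA [LHS]mulgA E.
by rewrite -[X in X * _]C -mulgA IH C.
Qed.

Lemma walk_val_walk (g : G) : walk_val (walk (val g)) = cls (wg g).
Proof.
rewrite -elt_val; case: (inG_cases (inG_val g)) => [G'g|->|->].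
- by rewrite walk_G' // walk_val_cat walk_val_ups // walk_val_dns.
- by rewrite /= !elt1 ?mulg1 ?mul1g elt_gxx' elt_xx'x.
- by rewrite /= !elt1 ?mulg1 ?mul1g elt_gxx' !mulgA elt_x'xx'.
Qed.

Lemma walk_val_word_walk w : walk_val (word_walk w) = cls w.
Proof.
elim/word_ind: w => [g|g w IH]; first by rewrite word_walk_wg walk_val_walk.
by rewrite word_walkM walk_val_cat IH word_walk_wg walk_val_walk clsM.
Qed.

Definition source m := match m with Up e => child e | Dn e => e.1 end.
Definition target m := match m with Up e => e.1 | Dn e => child e end.
Definition medge m := match m with Up e | Dn e => e end.

(** The moves of [ms] follow each other from [u] to [v] along edges of G^5. *)
Fixpoint joins (u : term) (ms : seq move) (v : term) : Prop :=
  if ms is m :: ms' then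
    [/\ G5 (medge m).1, source m = u & joins (target m) ms' v]
  else u = v.

Lemma joins_cat u m n w :
  joins u (m ++ n) w <-> exists2 v, joins u m v & joins v n w.
Proof.
elim: m u => [|x m IH] u /=.
  by split=> [?|[v -> //]]; exists u.
split=> [[Gx xu /IH[v ? ?]]|[v [Gx xu ?] ?]]; first by exists v.
by split=> //; apply/IH; exists v.
Qed.

Lemma joins_rcons u m x v : joins u (m ++ [:: x]) v <->
  [/\ G5 (medge x).1, joins u m (source x) & target x = v].
Proof.
rewrite joins_cat; split=> [[w mw [Gx xw <-]]|[Gx mx <-]].
  by split=> //; rewrite xw.
by exists (source x).
Qed.

Lemma joins_rev u l v : joins u (map Up l) v -> joins v (map Dn (rev l)) u.
Proof.
elim: l u => [|e l IH] u //= [Ge <- /IH le].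
by rewrite rev_cons map_rcons -cats1; apply/joins_rcons.
Qed.

Lemma joins_ups q : inG' q -> joins (Sym A1) (ups q) q.
Proof.
move=> Gq; elim/inG'_ind: q / Gq => [//||e f Ge Gf cE ef _ _ IH].
  by have := G5_gxx'.
have Gp := peak_G5 Ge Gf cE ef.
by rewrite ups_peak //; apply/joins_cat; exists (child e).
Qed.

Lemma joins_dns q : inG' q -> joins q (dns q) (Sym A1).
Proof.
move=> Gq; elim/inG'_ind: q / Gq => [//||e f Ge Gf cE ef _ _ IH].
  by have := G5_gxx'.
have Gp := peak_G5 Ge Gf cE ef.
by rewrite dns_peak //=; split=> //; split=> //; rewrite -cE.
Qed.

Lemma joins_walk (g : G) : joins (Sym A1) (walk (val g)) (Sym A1).
Proof.
have Gx := G5_gxx'.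
case: (inG_cases (inG_val g)) => [G'g|->|->] //.
rewrite walk_G' //; apply/joins_cat; exists (val g); first exact: joins_ups.
exact: joins_dns.
Qed.

Lemma joins_word_walk w : joins (Sym A1) (word_walk w) (Sym A1).
Proof.
elim/word_ind: w => [g|g w IH]; last first.
  rewrite word_walkM; apply/joins_cat; exists (Sym A1) => //.
  by rewrite word_walk_wg; exact: joins_walk.
by rewrite word_walk_wg; exact: joins_walk.
Qed.

(** A nonempty walk ends, as a word, with the idempotent letter it reaches; so
    that letter can be inserted wherever a relation needs it. *)
Lemma joins_end ms v : joins (Sym A1) ms v -> walk_val ms * elt v = walk_val ms.
Proof.
elim/last_ind: ms => [<-|ms m _]; first by rewrite elt1 mulg1.
rewrite -cats1 => /joins_rcons[Gm _ <-].
rewrite walk_val_cat /= mulg1 -mulgA; congr (_ * _).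
case: m Gm => e Ge /=; rewrite -mulgA elt_idem //; first by left.
exact: child_inG'.
Qed.

(** Both cases of [up] replace a valley by a walk of the same value, by
    [elt_pop] and [elt_peakC]; the letter that these equations require before
    the valley is supplied by [joins_end]. *)
Lemma walk_val_up e a d : G5 e.1 -> joins (Sym A1) (moves (a, d)) (child e) ->
  joins (Sym A1) (moves (up e a d)) e.1 /\
  walk_val (moves (up e a d)) = walk_val (moves (a, d)) * move_val (Up e).
Proof.
elim: d e => [|f d IH] e Ge.
  rewrite [up _ _ _]/= moves_up walk_val_cat /= mulg1 => J; split=> //.
  by apply/joins_rcons.
rewrite moves_dn => /joins_rcons[Gf J cE].
have vE := joins_end J; rewrite walk_val_cat /= mulg1 -vE.
have [->|/eqP ef] := eqVneq e f.
  split=> //; rewrite -!mulgA -[elt (child f) * _]/(elt _ * move_val (Up f)).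
  by have := elt_pop Gf; rewrite /= -!mulgA => ->.
have Gp := peak_G5 Ge Gf (esym cE) ef.
have [//|J' E] := IH (peak f e, true) Gp.
rewrite moves_dn -surjective_pairing walk_val_cat E /= mulg1; split.
  by apply/joins_rcons; split.
have := elt_peakC Ge Gf (esym cE) ef; rewrite /= !peak_edges !invK => E2.
rewrite -[in LHS]vE -!mulgA; congr (_ * _); rewrite !mulgA in E2 *.
by rewrite -E2.
Qed.

Definition normal ms := moves (act ([::], [::]) ms).

Lemma walk_val_normal ms v : joins (Sym A1) ms v ->
  joins (Sym A1) (normal ms) v /\ walk_val (normal ms) = walk_val ms.
Proof.
rewrite /normal; elim/last_ind: ms v => [//|ms m IH] v.
rewrite -cats1 => /joins_rcons[Gm /IH[J E] <-].
rewrite act_cat walk_val_cat /= mulg1 -E; case: (act _ ms) J {E} => a d J.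
case: m Gm J => e Ge J; first exact: walk_val_up.
rewrite /step moves_dn walk_val_cat /= mulg1; split=> //.
by apply/joins_rcons; split.
Qed.

Lemma cls_normal w : cls w = walk_val (normal (word_walk w)).
Proof.
by rewrite (walk_val_normal (joins_word_walk w)).2 walk_val_word_walk.
Qed.

(** The action on states is faithful: the word is recovered from the state that
    it makes of the empty one. *)
Lemma cls_acteq u v : acteq (word_walk u) (word_walk v) -> cls u = cls v.
Proof. by move=> uv; rewrite !cls_normal /normal uv. Qed.

(** * Regularity *)

Lemma walk_val_retrace p l v : joins p (map Dn l) v -> inG' p ->
  elt p * walk_val (map Dn l) * walk_val (map Up (rev l)) = elt p.
Proof.
elim: l p => [|e l IH] p /=; first by rewrite !mulg1.
move=> [Ge <- /IH/(_ (child_inG' Ge))E _].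
rewrite rev_cons map_rcons -cats1 walk_val_cat /= mulg1.
by rewrite -[RHS](elt_pop Ge) /= -[in RHS]E !mulgA.
Qed.

Lemma joins_inG' ms v : joins (Sym A1) ms v -> inG' v.
Proof.
elim/last_ind: ms => [<-|ms m _]; first by right.
rewrite -cats1 => /joins_rcons[Gm _ <-].
by case: m Gm => e Ge /=; [left|exact: child_inG'].
Qed.

(** The reverse of a mountain is an inverse of it: the valleys of the product
    cancel down to the peak. *)
Lemma F11_regular (s : F11) : exists t, s * t * s = s.
Proof.
have [w ->] := cls_surj s; rewrite cls_normal.
have [+ _] := walk_val_normal (joins_word_walk w); rewrite /normal /moves.
case: (act _ _) => a d /= /joins_cat[p Ja Jd].
have Gp := joins_inG' Ja; have ap := joins_end Ja.
exists (walk_val (map Up d) * walk_val (map Dn a)); rewrite walk_val_cat.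
have := walk_val_retrace Jd Gp; rewrite revK => dK.
have := joins_rev Ja; rewrite revK => /walk_val_retrace/(_ Gp) aK.
rewrite -{1}ap !mulgA -(mulgA _ (elt p)) -(mulgA _ (elt p * _)) dK.
by rewrite -(mulgA _ (elt p)) -(mulgA _ (elt p * _)) aK ap.
Qed.

(** * Weak generation *)

Lemma F1_regular : regular_semigroup F1.
Proof.
move=> s; have [t tE] := F11_regular (val s).
have [t1|tN1] := eqVneq t 1; last by exists (exist _ t tN1); exact: val_inj.
(* When the inverse found in the monoid is 1, the element is idempotent. *)
exists s; apply: val_inj; rewrite t1 mulg1 in tE.
by rewrite !gmulfM !tE.
Qed.

Lemma act_dn_inj l : injective (act^~ (map Dn l)).
Proof.
move=> [a d] [a' d']; rewrite /= !act_dn => -[-> /eqP].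
by rewrite eqseq_cat // eqxx => /eqP->.
Qed.

Lemma preinverse_x w :
    cls (wa Ax) * cls w * cls (wa Ax) = cls (wa Ax) -> cls w = cls (wa Ax').
Proof.
rewrite -!clsM => /word_walk_cls/(_ ([::], [::])) E; apply: cls_acteq.
rewrite word_walk_wa.
apply: (@act_loop (gxx', true) (gxx', false) [:: (gxx', false)]) => //.
apply: (@act_dn_inj [:: (gxx', true)]).
by move: E; rewrite !word_walkM !word_walk_wa !act_cat.
Qed.

(** This word uses smaller letters only, yet by the last relation its mountain
    has its peak at [g]. *)
Definition sandwiched (g : G) : word :=
  wg (gr g) * wa (gra g) * wg (gc g) * wa (inv (gla g)) * wg (gl g).

(** On the empty state, s t s = s says that t, between the descent from [g] to
    [gl g] and the ascent from [gr g] to [g], leaves an ascent unchanged. So t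
    amounts to climbing to [g] on the left and descending on the right, which is
    what the walk of [g] does at its top. *)
Lemma preinverse_peak (g : G) w : tall g ->
    cls (sandwiched g) * cls w * cls (sandwiched g) = cls (sandwiched g) ->
  cls (wg (gc g) * wa (inv (gla g)) * wg (gl g) * w *
       wg (gr g) * wa (gra g) * wg (gc g)) = cls (wg g).
Proof.
move=> gt; have [e [f [Ge Gf cE ef gE]]] := tallP gt.
have Gp : G5 (peak f e) by rewrite -gE; case: gt.
have [[GE GF] GP] := (inG'_G5 Ge, inG'_G5 Gf, inG'_G5 Gp).
have Gc := child_inG' Ge.
have [We Wf] := (edge_walkP Ge, edge_walkP Gf); rewrite /edge_walk -cE in Wf.
rewrite -!clsM => /word_walk_cls/(_ ([::], [::])) E; apply: cls_acteq => s.
pose l := (peak f e, false); pose r := (peak f e, true).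
have {E} S : acteq (dns e.1 ++ word_walk w ++ ups f.1) [:: Up l; Dn r].
  (* The ascent that [sandwiched g] makes from 1 to [g], through [gr g]. *)
  apply: (@act_loop _ _ (r :: rev (climb f.1))) => //.
  have swE s' : act s' (word_walk (sandwiched g)) =
      act (step (step (act s' (ups f.1)) (Up r)) (Dn l)) (dns e.1).
    rewrite /sandwiched !word_walkM !word_walk_wg !act_cat.
    rewrite /gla /gra /= gE /= ?invK.
    rewrite !(act_walk _ Gc, act_walk _ GE, act_walk _ GF).
    by rewrite (Wf _).2 (We _).1 act_peak.
  move: (sandwiched g) swE E => u uE; rewrite !word_walkM !act_cat !uE.
  have -> : act ([::], [::]) (ups f.1) = (rev (climb f.1), [::]).
    by rewrite /ups act_up cats0.
  by move=> E; apply: (@act_dn_inj (l :: descent e.1)).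
rewrite !word_walkM !word_walk_wg !act_cat.
rewrite /gla /gra /= gE /= ?invK.
rewrite !(act_walk _ Gc, act_walk _ GE, act_walk _ GF, act_walk _ GP).
rewrite (We _).1 (Wf _).2.
have := S (step (act s (ups (child e))) (Up e)); rewrite !act_cat => ->.
by rewrite act_ups // act_dns.
Qed.

(** By [preinverse_peak] a letter is a product of smaller letters and of any
    generalised inverse of its [sandwiched] word. *)
Lemma generation (P : F11 -> Prop) :
    P 1 -> (forall s t, P s -> P t -> P (s * t)) ->
    (forall s, P s -> exists2 t, P t & s * t * s = s) ->
    P (cls (wa Ax)) ->
  forall s, P s.
Proof.
move=> P1 PM Pr Px.
have Px' : P (cls (wa Ax')).
  have [t Pt] := Pr _ Px; have [w tE] := cls_surj t.
  by rewrite tE in Pt * => /preinverse_x <-.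
have Pa a : P (cls (wa a)) by case: a.
suff Pg t : inG' t -> P (elt t).
  have {}Pg g : P (cls (wg g)).
    rewrite -elt_val; case: (inG_cases (inG_val g)) => [/Pg //|->|->];
    by rewrite elt_sym.
  move=> s; have [w ->] := cls_surj s; elim/word_ind: w => [//|g w IH].
  by rewrite clsM; apply: (PM).
move=> Gt; elim/inG'_ind: t / Gt => [||e f Ge Gf cE ef Pl Pr' Pc].
- by rewrite elt1.
- by rewrite elt_gxx' !elt_sym; apply: (PM).
have [g gt gE] := peak_ex Ge Gf cE ef; rewrite -gE elt_val.
have {}Pl : P (cls (wg (gl g))) by rewrite -elt_val /= gE.
have {}Pr' : P (cls (wg (gr g))) by rewrite -elt_val /= gE.
have {}Pc : P (cls (wg (gc g))) by rewrite -elt_val /= gE.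
have Psw : P (cls (sandwiched g)).
  by rewrite /sandwiched !clsM; do ?[exact: Pa|assumption|apply: (PM)].
have [t Pt] := Pr _ Psw; have [w tE] := cls_surj t.
rewrite tE in Pt * => /preinverse_peak <- //.
by rewrite !clsM; do ?[exact: Pa|assumption|apply: (PM)].
Qed.

Theorem proposition4p9 : regular_semigroup F1 /\ weakly_generated_by F1_x.
Proof.
split; first exact: F1_regular.
case=> T [[[_ TM] Tr] Tx [_ TN]]; apply: TN => s _.
have TP : forall u, u = 1 \/ exists2 h : F1, T h & val h = u.
  apply: generation.
  - by left.
  - move=> u v [->|[h Th <-]]; first by rewrite mul1g.
    case=> [->|[k Tk <-]]; right; first by rewrite mulg1; exists h.
    by exists (h * k); [exact: TM|exact: gmulfM].
  - move=> u [->|[h Th <-]]; first by exists 1; [left|rewrite !mulg1].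
    have [k Tk hkh] := Tr h Th; exists (val k); first by right; exists k.
    by rewrite -!gmulfM hkh.
  - by right; exists F1_x.
case: (TP (val s)) => [s1|[h Th /val_inj<- //]].
by have := valP s; rewrite /= s1 eqxx.
Qed.
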